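(* For $\mathcal G_1,\mathcal G_2\in M_{\underline d}$ the Shapovalov form on the universal Verma module $M$ is given by $$(\mathcal G_1,\mathcal G_2)=(-1)^{\sum_{i=1}^{n-1}d_i}\,v^{\sum_{i=1}^{n-1}2id_i^2-\sum_{i=2}^{n-1}(2i-1)d_id_{i-1}}\prod_{i=1}^nt_i^{(2i-1)(d_{i-1}-d_i)}\,\big[R\Gamma(\mathfrak Q_{\underline d},\mathcal G_1\otimes\mathcal G_2\otimes\mathfrak D_{\underline d})\big].$$
   Context: Work over $\mathbb C$; $n\ge2$. Geometry: $\mathbf C=\mathbb P^1$ with coordinate $z$ and points $0,\infty$; $\mathbb C^*$ acts by $v(z)=v^{-2}z$. $W$ is a vector space with basis $w_1,\dots,w_n$; the torus $\widetilde T=\{(t_1,\dots,t_n): t_1\cdots t_n=1\}$ acts on $W$ by $\underline t(w_i)=t_i^2w_i$. For $\underline d=(d_1,\dots,d_{n-1})\in\mathbb Z_{\ge0}^{n-1}$ (with $d_0=d_n=0$), $\mathfrak Q_{\underline d}$ is the moduli space of flags of locally free subsheaves $0\subset\mathcal W_1\subset\dots\subset\mathcal W_{n-1}\subset W\otimes\mathcal O_{\mathbf C}$ with $\operatorname{rank}\mathcal W_k=k$, $\deg\mathcal W_k=-d_k$, such that near $\infty$ each $\mathcal W_i$ is a vector subbundle with fibre $\langle w_1,\dots,w_i\rangle$ at $\infty$. It is a smooth quasiprojective variety of dimension $2\sum d_i$ with an action of $\widetilde T\times\mathbb C^*$ (it is empty if some $d_i<0$). Write $\underline d\pm i$ for $\underline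 d$ with $d_i$ replaced by $d_i\pm1$. $\mathfrak E_{\underline d,i}\subset\mathfrak Q_{\underline d}\times\mathfrak Q_{\underline d+i}$ is the (smooth) correspondence of pairs $(\mathcal W_\bullet,\mathcal W'_\bullet)$ with $\mathcal W_j=\mathcal W'_j$ for $j\ne i$ and $\mathcal W'_i\subset\mathcal W_i$; $\mathbf p,\mathbf q$ are its projections to $\mathfrak Q_{\underline d}$ and $\mathfrak Q_{\underline d+i}$; $\mathfrak L_i$ is the line bundle on it with fibre $\Gamma(\mathbf C,\mathcal W_i/\mathcal W'_i)$. $K$-theory: $\mathbb F=\operatorname{Frac}(\mathbb C[\widetilde T\times\mathbb C^*])$, with $\mathbb C[\widetilde T\times\mathbb C^*]=\mathbb C[t_1^{\pm1},\dots,t_n^{\pm1},v^{\pm1}]/(t_1\cdots t_n-1)$. $M_{\underline d}=K^{\widetilde T\times\mathbb C^*}(\mathfrak Q_{\underline d})\otimes\mathbb F$ (complexified equivariant $K$-theory, localized) and $M=\bigoplus_{\underline d}M_{\underline d}$. The $\widetilde T\times\mathbb C^*$-fixed points of $\mathfrak Q_{\underline d}$ are indexed by collections $\widetilde{\underline d}=(d_{ij})_{1\le j\le i\le n-1}$ of nonnegative integers with $d_i=\sum_{j\le i}d_{ij}$ and $d_{kj}\ge d_{ij}$ for $i\ge k\ge j$; the corresponding flag is $\mathcal W_i=\bigoplus_{j\le i}\mathcal O_{\mathbf C}(-d_{ij}\cdot0)w_j$. The classes $[\widetilde{\underline d}]$ of the structure sheaves of the fixed points form an $\mathbb F$-basis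 of $M$. Convention for characters and direct images: the function $z$ has character $v^{-2}$ and $w_i$ has character $t_i^2$, so e.g. $\operatorname{Hom}(\mathcal O_{\mathbf C}(-a\cdot 0),\mathcal O_{\mathbf C})$ has character $\sum_{c=0}^av^{2c}$. At a fixed point $x$ of a smooth variety $X$ put $S\chi_x=\prod_\chi(1-\chi)^{-1}$, the product over the weights $\chi$ of $T_xX$ (the character of $\operatorname{Sym}^\bullet T_xX$). Direct images are defined by localization: $\mathbf p_*\mathbf q^*[\widetilde{\underline d}{}']=\sum_{\widetilde{\underline d}}\frac{S\chi_{(\widetilde{\underline d},\widetilde{\underline d}{}')}}{S\chi_{\widetilde{\underline d}{}'}}[\widetilde{\underline d}]$ and $\mathbf q_*(\mathfrak L_i\otimes\mathbf p^* )[\widetilde{\underline d}]=\sum_{\widetilde{\underline d}{}'}\lambda\,\frac{S\chi_{(\widetilde{\underline d},\widetilde{\underline d}{}')}}{S\chi_{\widetilde{\underline d}}}[\widetilde{\underline d}{}']$, sums over fixed points $(\widetilde{\underline d},\widetilde{\underline d}{}')$ of $\mathfrak E_{\underline d,i}$, $\lambda$ the character of the fibre of $\mathfrak L_i$ there; and $[R\Gamma(\mathfrak Q_{\underline d},\mathcal G)]=\sum_x\mathcal G|_x\,S\chi_x\in\mathbb F$, sum over the fixed points $x$ of $\mathfrak Q_{\underline d}$, where $[\widetilde{\underline d}]|_{\widetilde{\underline d}}=1/S\chi_{\widetilde{\underline d}}$ and $[\widetilde{\underline d}]$ restricts to $0$ at other fixed points. Operators, for $1\le i\le n-1$, given by their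 restriction to $M_{\underline d}$: $F_i=t_{i+1}^it_i^{-i}v^{2id_i-id_{i-1}-id_{i+1}-i}\,\mathbf p_*\mathbf q^*:M_{\underline d}\to M_{\underline d-i}$; $E_i=-t_{i+1}^{-i-1}t_i^{i-1}v^{(i-1)d_{i-1}+(i+1)d_{i+1}-2id_i-i}\,\mathbf q_*(\mathfrak L_i\otimes\mathbf p^* ):M_{\underline d}\to M_{\underline d+i}$. They make $M$ the universal Verma module over $U_v(\mathfrak{sl}_n)$ with lowest weight vector $[(0,\dots,0)]$. The Shapovalov form is the symmetric $\mathbb F$-bilinear form $(\,,)$ on $M$ characterized by $([(0,\dots,0)],[(0,\dots,0)])=1$ and $(E_ix,y)=(x,F_iy)$ for all $x,y\in M$ and all $i$; different $M_{\underline d}$ are orthogonal. $\mathfrak D_i$ is the line bundle on $\mathfrak Q_{\underline d}$ whose fibre at $\mathcal W_\bullet$ equals $\det R\Gamma(\mathbf C,\mathcal W_i)$, and $\mathfrak D_{\underline d}=\bigotimes_{i=1}^{n-1}\mathfrak D_i$.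
   Formalization: The right-hand side is divided by the constant character of the fibre of D_0 at the lowest weight point, the product over 1≤j≤i≤n-1 of t_j^2; without this the formula contradicts ([0],[0])=1 (for n=2, d=0 it gives t_1^2). *)

(* Defs.v *)
From HB Require Import structures.
From mathcomp Require Import all_boot all_order all_algebra.
From mathcomp Require Import finmap.
From mathcomp Require Import boolp classical_sets fsbigop reals.
From mathcomp Require Import complex freeg mpoly.

Set Implicit Arguments.
Unset Strict Implicit.
Unset Printing Implicit Defensive.

Import Order.TTheory GRing.Theory Num.Theory.
Local Open Scope ring_scope.

(* The field Frac C[T~ x C^*].  The subtorus t_1 ... t_n = 1 has coordinates
   t_1, ..., t_{n-1}, so its coordinate ring with v adjoined is a localization
   of a polynomial ring in (n - 1) + 1 variables: t_1, ..., t_{n-1}, and v as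
   the last one.  All indices i, j, k below are 1-based, as in t_1, ..., t_n. *)
Definition FF (R : realType) (n : nat) : fieldType :=
  {fraction {mpoly R[i][n.-1.+1]}}.

Section TorusField.
Variables (R : realType) (n : nat).

Definition vpar : FF R n := tofrac ('X_ord_max : {mpoly R[i][n.-1.+1]}).

Definition tvar (j : nat) : FF R n :=
  tofrac ('X_(inord j.-1) : {mpoly R[i][n.-1.+1]}).

Definition tpar (j : nat) : FF R n :=
  if (j < n)%N then tvar j else (\prod_(1 <= l < n) tvar l)^-1.

Lemma tvar_neq0 j : tvar j != 0.
Proof.
by rewrite /tvar tofrac_eq0; apply/negP => /eqP/(congr1 (mcoeff U_(inord j.-1)%MM));
  rewrite mcoeffX eqxx mcoeff0 => /eqP; rewrite oner_eq0.
Qed.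

Lemma prod_tpar : (0 < n)%N -> \prod_(1 <= j < n.+1) tpar j = 1.
Proof.
move=> n_gt0; rewrite big_nat_recr //= {2}/tpar ltnn.
rewrite (@eq_big_nat _ _ _ _ _ _ tvar); last by move=> j /andP[_ jn]; rewrite /tpar jn.
by rewrite mulfV // prodf_seq_neq0; apply/allP => j _; exact: tvar_neq0.
Qed.

(* The character of the monomial section z^m w_j. *)
Definition chmon (j : nat) (m : int) : FF R n := tpar j ^+ 2 * vpar ^ (- 2 * m).

End TorusField.

(* The subsheaf \bigoplus_(1 <= j <= r) O(-a_j 0) w_j of W \otimes O. *)
Record msheaf := MSheaf { mrank : nat; mord : nat -> nat }.

(* [hom_mon n A B j k c]: whether z^(-c) w_k \otimes w_j^* defines a nonzero
   section of Hom(A, (W \otimes O) / B), for A contained in B, that vanishes at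
   infinity.  It sends the generator z^(a_j) w_j of A at 0 to z^(a_j - c) w_k,
   which must be regular at 0.  If w_k occurs in B, the w_k-part of the quotient
   is O/z^(b_k), supported at 0.  Otherwise it is O, and vanishing at infinity
   means c > 0. *)
Definition hom_mon (n : nat) (A B : msheaf) (j k : nat) (c : int) : bool :=
  [&& (0 < j <= mrank A)%N, (0 < k <= n)%N, c <= (mord A j)%:Z
    & if (k <= mrank B)%N then (mord A j)%:Z - c < (mord B k)%:Z else 0 < c].

(* Zariski tangent space, at a torus-fixed point, of the moduli space of
   families (W_p) of subsheaves of W \otimes O with prescribed inclusions
   W_p \subset W_q (for [incl p q]) and fixed fibres at infinity.  A tangent
   vector is a family phi_p : W_p -> (W \otimes O)/W_p of maps vanishing at
   infinity with phi_q|W_p = phi_p mod W_q whenever W_p \subset W_q. *)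
Section Tangent.
Variables (R : realType) (n : nat) (P : finType) (W : P -> msheaf) (incl : rel P).

(* [hom_mon n (W p) (W q) j k c] forces |c| <= tbound. *)
Definition tbound : nat := (\sum_(p : P) \sum_(1 <= j < n) mord (W p) j)%N.

(* (j, k, m) stands for the monomial z^(-c) w_k \otimes w_j^*, c = m - tbound. *)
Definition tmono : finType := ('I_n.+1 * 'I_n.+1 * 'I_tbound.*2.+1)%type.
Definition tshift (b : tmono) : int := (b.2 : nat)%:Z - tbound%:Z.
Definition thom (p q : P) (b : tmono) : bool :=
  hom_mon n (W p) (W q) b.1.1 b.1.2 (tshift b).
Definition tchar (b : tmono) : FF R n :=
  tpar R n b.1.2 ^+ 2 / tpar R n b.1.1 ^+ 2 * vpar R n ^ (2 * tshift b).

Definition tambient : vectType R[i] := {ffun P * tmono -> R[i]^o}.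

Definition tcoord (x : P * tmono) (f : tambient) : R[i]^o := f x.

Fact tcoord_is_linear x : linear (tcoord x).
Proof. by move=> a f g; rewrite /tcoord !ffunE. Qed.
HB.instance Definition _ x :=
  GRing.isLinear.Build R[i] tambient R[i]^o _ (tcoord x) (tcoord_is_linear x).

Definition tangent : {vspace tambient} :=
  ((\bigcap_(x : P * tmono | ~~ thom x.1 x.1 x.2) lker (linfun (tcoord x))) :&:
   (\bigcap_(y : P * P * tmono | incl y.1.1 y.1.2 && thom y.1.1 y.1.2 y.2)
      lker (linfun (tcoord (y.1.1, y.2)) - linfun (tcoord (y.1.2, y.2)))))%VS.

Definition weight_space (chi : FF R n) : {vspace tambient} :=
  (\bigcap_(x : P * tmono | tchar x.2 != chi) lker (linfun (tcoord x)))%VS.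

Lemma mem_tangent (f : tambient) :
  f \in tangent <->
  (forall p b, ~~ thom p p b -> f (p, b) = 0) /\
  (forall p q b, incl p q -> thom p q b -> f (p, b) = f (q, b)).
Proof.
have in_cap (I : finType) (Q : pred I) (V : I -> {vspace tambient}) (g : tambient) :
  g \in (\bigcap_(i | Q i) V i)%VS <-> forall i, Q i -> g \in V i.
- rewrite memvE; split => [/subv_bigcapP H i Qi|H]; first by rewrite memvE; exact: H.
  by apply/subv_bigcapP => i Qi; rewrite -memvE; exact: H.
rewrite /tangent memv_cap; split.
- case/andP => /in_cap H1 /in_cap H2; split.
    by move=> p b pb; have := H1 (p, b) pb; rewrite memv_ker lfunE => /eqP.
  move=> p q b pq pqb; have := H2 (p, q, b); rewrite /= pq pqb => /(_ isT).
  by rewrite memv_ker add_lfunE opp_lfunE !lfunE /= subr_eq0 => /eqP.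
- case=> H1 H2; apply/andP; split; apply/in_cap.
    by case=> p b pb; rewrite memv_ker lfunE /= /tcoord H1.
  case=> [[p q] b] /andP[/= pq pqb]; rewrite memv_ker add_lfunE opp_lfunE !lfunE /=.
  by rewrite subr_eq0 /tcoord (H2 _ _ _ pq pqb).
Qed.

(* Distinct characters of the torus are distinct elements of FF. *)
Definition Schi : FF R n :=
  \prod_(chi <- undup [seq tchar b | b : tmono])
     (1 - chi) ^- \dim (tangent :&: weight_space chi)%VS.

End Tangent.

(* Torus-fixed points: the collections (d_ij), 1 <= j <= i <= n-1, stored at the
   0-based position (i-1, j-1). *)
Definition is_fixpt (m : nat) (x : 'M[nat]_m) : bool :=
  [forall p : 'I_m, forall q : 'I_m, (p < q)%N ==> (x p q == 0%N)] &&
  [forall q : 'I_m, forall p : 'I_m, forall r : 'I_m,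
     (q <= p <= r)%N ==> (x r q <= x p q)%N].

Record fixpt (n : nat) :=
  FixPt { fixpt_mx : 'M[nat]_n.-1; fixptP : is_fixpt fixpt_mx }.
HB.instance Definition _ n := [isSub for @fixpt_mx n].
HB.instance Definition _ n := [Choice of fixpt n by <:].

Section FixedPoints.
Variable n : nat.
Implicit Types x y : fixpt n.

(* d_ij, with value 0 outside 1 <= i, j <= n-1. *)
Definition dij x (i j : nat) : nat :=
  (\sum_(p : 'I_n.-1 | p.+1 == i) \sum_(q : 'I_n.-1 | q.+1 == j) fixpt_mx x p q)%N.

Definition ddeg x (i : nat) : nat := (\sum_(1 <= j < i.+1) dij x i j)%N.

Fact vac_subproof : is_fixpt (const_mx 0%N : 'M[nat]_n.-1).
Proof.
apply/andP; split.
  by apply/forallP => p; apply/forallP => q; rewrite mxE eqxx implybT.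
by apply/forallP => p; apply/forallP => q; apply/forallP => r; rewrite !mxE implybT.
Qed.
Definition vac : fixpt n := FixPt vac_subproof.

(* d_i for a dimension vector d, with d_0 = d_n = 0. *)
Definition dcomp (d : n.-1.-tuple nat) (i : nat) : nat := nth 0%N (0%N :: d) i.

Definition Qfix (d : n.-1.-tuple nat) : set (fixpt n) :=
  [set x | forall i, (0 < i < n)%N -> ddeg x i = dcomp d i]%classic.

Definition flag x (i : nat) : msheaf := MSheaf i (dij x i).

(* (x, y) is a fixed point of the correspondence E_{d,i}: W_k(x) = W_k(y) for
   k <> i and W_i(y) \subset W_i(x) with colength 1. *)
Definition corr (i : nat) x y : bool :=
  [&& [forall p : 'I_n.-1, forall q : 'I_n.-1,
         (p.+1 != i) ==> (fixpt_mx x p q == fixpt_mx y p q)],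
      [forall p : 'I_n.-1, forall q : 'I_n.-1,
         (p.+1 == i) ==> (fixpt_mx x p q <= fixpt_mx y p q)%N]
    & ddeg y i == (ddeg x i).+1].

End FixedPoints.

Section KTheory.
Variables (R : realType) (n : nat).
Local Notation F := (FF R n).
Local Notation t := (tpar R n).
Local Notation v := (vpar R n).
Implicit Types (x y : fixpt n) (i : nat).

(* Sym of the tangent space of the Laumon space Q_d at x. *)
Definition SQ x : F :=
  Schi R n (fun p : 'I_n.-1 => flag x p.+1) (fun p q => p.+1 == q :> nat).

(* Sym of the tangent space of E_{d,i} at (x, y); the index (false, p) refers to
   the flag x and (true, p) to the flag y.  An equality of subsheaves is imposed
   as two inclusions. *)
Definition SE i x y : F :=
  Schi R n
    (fun a : bool * 'I_n.-1 => flag (if a.1 then y else x) a.2.+1)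
    (fun a b => if a.1 == b.1 then a.2.+1 == b.2 :> nat
                else (a.2 == b.2) && ((a.2.+1 != i) || a.1)).

(* M, free on the classes [x] = << x >> of the fixed points. *)
Definition MM : lmodType F := {freeg (fixpt n) / F}.
Definition fixcls x : MM := (<< x >> : {freeg (fixpt n) / F}).
Definition mcoord (G : MM) x : F := coeff x (G : {freeg (fixpt n) / F}).

Definition inM (d : n.-1.-tuple nat) (G : MM) : Prop :=
  forall x, mcoord G x != 0 -> Qfix d x.

(* Character of the fibre Gamma(W_i / W'_i) of L_i at (x, y). *)
Definition Lfib i x y : F :=
  \sum_(1 <= j < i.+1) \sum_(dij x i j <= m < dij y i j) chmon R n j m%:Z.

Definition pq_push i y : MM :=
  \sum_(x \in [set x | corr i x y]%classic) (SE i x y / SQ y) *: fixcls x.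

Definition qLp_push i x : MM :=
  \sum_(y \in [set y | corr i x y]%classic)
     (Lfib i x y * (SE i x y / SQ x)) *: fixcls y.

Definition Fop i : MM -> MM := fglift (fun y =>
  (t i.+1 ^ i%:Z * t i ^ (- i%:Z) *
   v ^ (2 * i%:Z * (ddeg y i)%:Z - i%:Z * (ddeg y i.-1)%:Z
        - i%:Z * (ddeg y i.+1)%:Z - i%:Z)) *: pq_push i y).

Definition Eop i : MM -> MM := fglift (fun x =>
  (- (t i.+1 ^ (- i%:Z - 1) * t i ^ (i%:Z - 1) *
      v ^ ((i%:Z - 1) * (ddeg x i.-1)%:Z + (i%:Z + 1) * (ddeg x i.+1)%:Z
           - 2 * i%:Z * (ddeg x i)%:Z - i%:Z))) *: qLp_push i x).

Definition is_Shapovalov (B : MM -> MM -> F) : Prop :=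
  [/\ (forall G1 G2, B G1 G2 = B G2 G1),
      (forall a G1 G2 G3, B (a *: G1 + G2) G3 = a * B G1 G3 + B G2 G3),
      B (fixcls (vac n)) (fixcls (vac n)) = 1
    & forall i, (0 < i < n)%N ->
        forall G1 G2, B (Eop i G1) G2 = B G1 (Fop i G2)].

(* The character of det R Gamma(P^1, O(-a 0) w_j).  In the cover by P^1 - oo and
   P^1 - 0, the monomials z^m with m >= a (resp. m <= 0) are the sections of
   O(-a 0); H^0 is spanned by those with a <= m <= 0, and H^1 by those with
   0 < m < a. *)
Definition detRG (a j : nat) : F :=
  (\prod_(0 <= m < a.+1 | (a <= m <= 0)%N) chmon R n j m%:Z)
  / (\prod_(1 <= m < a) chmon R n j m%:Z).

(* The fibre at x of D_d = \bigotimes_i det R Gamma(W_i). *)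
Definition Dfib x : F :=
  \prod_(1 <= i < n) \prod_(1 <= j < i.+1) detRG (dij x i j) j.

Definition restr (G : MM) x : F := mcoord G x / SQ x.

(* [R Gamma(Q_d, g)], where g is given by its restrictions to the fixed points. *)
Definition RGamma (d : n.-1.-tuple nat) (g : fixpt n -> F) : F :=
  \sum_(x \in Qfix d) g x * SQ x.

End KTheory.

Lemma dij_vac n i j : dij (vac n) i j = 0%N.
Proof. by rewrite /dij big1 // => p _; rewrite big1 // => q _; rewrite mxE. Qed.

(* The form with value 1 at the lowest weight vector is obtained after twisting
   D_d by the inverse of this nontrivial character. *)
Lemma Dfib_vac (R : realType) n :
  Dfib R (vac n) = \prod_(1 <= i < n) \prod_(1 <= j < i.+1) tpar R n j ^+ 2.
Proof.
apply: eq_bigr => i _; apply: eq_bigr => j _.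
rewrite dij_vac /detRG big_mkcond big_nat1 /= big_geq // divr1.
by rewrite /chmon mulr0 expr0z mulr1.
Qed.

(* Main.v *)
Require Import Defs.
From HB Require Import structures.
From mathcomp Require Import all_boot all_order all_algebra.
From mathcomp Require Import finmap.
From mathcomp Require Import boolp classical_sets cardinality fsbigop reals.
From mathcomp Require Import complex freeg mpoly.
From mathcomp Require Import zify ring.

Set Implicit Arguments.
Unset Strict Implicit.
Unset Printing Implicit Defensive.

Import Order.TTheory GRing.Theory Num.Theory.
Local Open Scope ring_scope.

(* The right-hand side of the formula is a form that is diagonal in the basis of
   fixed points.  In the matrix coefficients of E_i and F_i at a pair (x, y) the
   factor S chi_(x, y) / (S chi_x S chi_y) is common to both sides of the
   adjunction, and the character of L_i is the quotient of the fibres of D at x and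
   y, so adjointness is an identity between Laurent monomials.

   Uniqueness amounts to the E_i generating M from [(0, ..., 0)].  The fixed points
   are isolated, hence no matrix coefficient of E_i vanishes.  Suppose that
   the columns of x are constant down to row r, but not down to row r + 1.  Then
   some box can be removed from row r of x, giving x', and E_r [x'] is a nonzero
   multiple of [x] plus a combination of patterns that are not constant down to row
   r.  Induction on r puts every [x] with x <> 0 in the sum of the images of the E_i. *)

(** * Laurent monomials in the torus coordinates; independence of characters *)

Section Torus.
Variables (R : realType) (n : nat).

Definition laurent (e : 'I_n.-1.+1 -> int) : FF R n :=
  \prod_i (tofrac ('X_i : {mpoly R[i][n.-1.+1]})) ^ e i.

Lemma tofracX_neq0 (i : 'I_n.-1.+1) :
  tofrac ('X_i : {mpoly R[i][n.-1.+1]}) != 0 :> FF R n.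
Proof. by rewrite tofrac_eq0 -msize_poly_eq0 msizeX. Qed.

Lemma laurentD e f : laurent e * laurent f = laurent (fun i => e i + f i).
Proof.
by rewrite -big_split; apply: eq_bigr => i _ /=; rewrite -expfzDr // tofracX_neq0.
Qed.

Lemma laurentX e (z : int) : laurent e ^ z = laurent (fun i => e i * z).
Proof.
rewrite /laurent; case: z => k.
  rewrite -exprnP -prodrXl; apply: eq_bigr => i _; by rewrite exprnP exprz_exp.
rewrite NegzE -exprnN -prodrXl -prodfV; apply: eq_bigr => i _.
by rewrite exprnN exprz_exp.
Qed.

Lemma laurent_mnm (m : 'X_{1..n.-1.+1}) :
  laurent (fun i => (m i)%:Z) = tofrac ('X_[m] : {mpoly R[i][n.-1.+1]}).
Proof.
rewrite mpolyXE_id rmorph_prod; apply: eq_bigr => i _.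
by rewrite rmorphXn.
Qed.

(** Multiplying by the monomial [q] of negative parts gives an equality of polynomial monomials with
    exponents [p] and [q]. Hence [p = q], and at most one of [p i], [q i] is nonzero. *)
Lemma laurent_eq1 e : laurent e = 1 -> forall i, e i = 0.
Proof.
pose p := [multinom if (0 <= e i)%R then absz (e i) else 0%N | i < n.-1.+1].
pose q := [multinom if (0 <= e i)%R then 0%N else absz (e i) | i < n.-1.+1].
have pq : laurent e * laurent (fun i => (q i)%:Z) = laurent (fun i => (p i)%:Z).
  rewrite laurentD; apply: eq_bigr => i _; congr (_ ^ _).
  rewrite !mnmE; case: ifP => h; lia.
move=> e1; move: pq; rewrite e1 mul1r !laurent_mnm => /eqP.
rewrite tofrac_eq => /eqP/(congr1 (mcoeff q)); rewrite !mcoeffX eqxx.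
case: eqP => [pq _ i|_ /eqP]; last by rewrite oner_eq0.
have : p i = q i by rewrite pq.
rewrite !mnmE; case: ifP => h; lia.
Qed.

(** Since $t_n$ is the inverse of $t_1\cdots t_{n-1}$, its exponent is -1 at each of these
    coordinates and 0 at the last one, which is $v$. *)
Definition tpar_exp (j : nat) (i : 'I_n.-1.+1) : int :=
  if (j < n)%N then (i == inord j.-1)%:Z else - (i < n.-1)%:Z.

Lemma laurent1 i : tofrac ('X_i : {mpoly R[i][n.-1.+1]}) = laurent (fun k => (k == i)%:Z).
Proof.
rewrite /laurent (bigD1 i) //= eqxx expr1z big1 ?mulr1 // => k /negPf ->.
by rewrite expr0z.
Qed.

Lemma tparE j : (0 < n)%N -> tpar R n j = laurent (tpar_exp j).
Proof.
move=> n_gt0; rewrite /tpar; case: ifP => jn.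
  rewrite /tvar laurent1; apply: eq_bigr => i _.
  by rewrite /tpar_exp jn.
have -> : \prod_(1 <= l < n) tvar R n l = laurent (fun i => (i < n.-1)%:Z).
  rewrite /laurent big_ord_recr /= ltnn expr0z mulr1.
  rewrite big_add1 /= big_mkord; apply: eq_bigr => i _.
  rewrite ltn_ord expr1z /tvar /=; congr (tofrac 'X__).
  by apply: val_inj; rewrite /= inordK // ltnW // ltnS.
rewrite -exprN1 laurentX; apply: eq_bigr => i _; rewrite /tpar_exp jn.
by rewrite mulrN1.
Qed.

Lemma vparE : vpar R n = laurent (fun i => (i == ord_max)%:Z).
Proof. exact: laurent1. Qed.

Lemma vpar_neq0 : vpar R n != 0.
Proof. exact: tofracX_neq0. Qed.

Lemma tpar_neq0 j : tpar R n j != 0.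
Proof.
rewrite /tpar; case: ifP => _; first exact: tvar_neq0.
by rewrite invr_eq0 prodf_seq_neq0; apply/allP => l _; exact: tvar_neq0.
Qed.

Lemma chmon_neq0 j m : chmon R n j m != 0.
Proof. apply: mulf_neq0; first exact: expf_neq0 (tpar_neq0 j).
exact: expfz_neq0 vpar_neq0. Qed.

(** As [j < n], $t_j$ is itself a coordinate. If [k] differs from [j], its exponent in the quotient
    is -2 for [k < n] and -4 for [k = n], never 0; if [k = j], only $v^{2c}$ is left. *)
Lemma character_eq1 (j k : nat) (c : int) : (0 < j < n)%N -> (0 < k <= n)%N ->
  tpar R n k ^+ 2 / tpar R n j ^+ 2 * vpar R n ^ (2 * c) = 1 -> j = k /\ c = 0.
Proof.
move=> /andP[j0 jn] /andP[k0 kn].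
have n0 : (0 < n)%N by lia.
rewrite !tparE // vparE exprnN exprnP !laurentX !laurentD => /laurent_eq1 e0.
have jmax : (inord j.-1 == ord_max :> 'I_n.-1.+1) = false.
  by apply/eqP => /(congr1 val); rewrite /= inordK; lia.
have kj : k = j.
  have := e0 (inord j.-1); rewrite /tpar_exp jn jmax eqxx.
  case: ifP => kn'; last by rewrite inordK; lia.
  case: eqP => [/(congr1 val)|]; last by lia.
  by rewrite /= !inordK; lia.
split=> //; have := e0 ord_max; rewrite kj /tpar_exp jn eqxx; lia.
Qed.

(** * The factors $S\chi$ at fixed points *)

Section Weights.
Variables (P : finType) (W : P -> msheaf) (incl : rel P).

(* The fixed points are isolated: the invariant monomials are [w_j \otimes w_j^*], and
   these map [W_p] into itself. *)
Lemma Schi_neq0 : (forall p, (mrank (W p) < n)%N) -> Schi R n W incl != 0.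
Proof.
move=> rk; rewrite prodf_seq_neq0; apply/allP => chi _ /=.
rewrite invr_eq0; have [->|chi1] := eqVneq chi 1; last first.
  by apply: expf_neq0; rewrite subr_eq0 eq_sym.
suff -> : (tangent R n W incl :&: weight_space W 1 = 0)%VS by rewrite dimv0 expr0 oner_eq0.
apply/eqP; rewrite -subv0; apply/subvP => f.
rewrite memv_cap memv0 => /andP[/mem_tangent[f0 _]] fw.
apply/eqP/ffunP => -[p b]; rewrite [RHS]ffunE.
have [c1|c1] := eqVneq (tchar R b) 1; last first.
  have /subv_bigcapP/(_ (p, b) c1) := fw.
  by rewrite -memvE memv_ker lfunE => /eqP.
apply: f0; apply/negP => /and4P[/andP[j0 jr] kn _].
have jn := leq_ltn_trans jr (rk p).
have [|<- ->] := character_eq1 _ kn c1; first by rewrite j0.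
by rewrite jr subr0 ltxx.
Qed.

(** With all orders 0, [hom_mon] asks for [c <= 0] and, in both branches of its last condition, for
    [0 < c]. So the tangent space is zero and every exponent in the product is 0. *)
Lemma Schi_eq1 : (forall p j, mord (W p) j = 0%N) -> Schi R n W incl = 1.
Proof.
move=> W0; rewrite /Schi big1_seq // => chi _.
suff -> : (tangent R n W incl :&: weight_space W chi = 0)%VS by rewrite dimv0 expr0 invr1.
apply/eqP; rewrite -subv0; apply/subvP => f.
rewrite memv_cap memv0 => /andP[/mem_tangent[f0 _]] _.
apply/eqP/ffunP => -[p b]; rewrite [RHS]ffunE.
apply: f0; apply/negP => /and4P[_ _]; rewrite !W0; case: ifP => _; lia.
Qed.

End Weights.
End Torus.

(** * Combinatorics of the patterns $(d_{ij})$ and of the correspondences *)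

Section Patterns.
Variable n : nat.
Implicit Types x y z : fixpt n.

Lemma dij_ord x (p q : 'I_n.-1) : dij x p.+1 q.+1 = fixpt_mx x p q.
Proof. by rewrite /dij (big_pred1 p) // (big_pred1 q). Qed.

Lemma dij_row_out x i j : ~~ (0 < i < n)%N -> dij x i j = 0%N.
Proof.
move=> iN; rewrite /dij big1 // => p /eqP pi; case/negP: iN; rewrite -pi.
by have := ltn_ord p; lia.
Qed.

Lemma dij_col0 x i : dij x i 0 = 0%N.
Proof. by rewrite /dij big1 // => p _; rewrite big1. Qed.

Lemma dij_above x i j : (i < j)%N -> dij x i j = 0%N.
Proof.
move=> ij; rewrite /dij big1 // => p /eqP pi; rewrite big1 // => q /eqP qj.
have /andP[/forallP/(_ p)/forallP/(_ q) + _] := fixptP x.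
by rewrite -pi -qj ltnS in ij; rewrite ij => /eqP.
Qed.

(** The first alternative is uniform in [x], so that one case split serves for comparing two
    patterns. *)
Lemma dij_cases i j : (forall x, dij x i j = 0%N) \/ exists p q : 'I_n.-1, i = p.+1 /\ j = q.+1.
Proof.
have [/andP[i0 iN]|iN] := boolP (0 < i < n)%N; last by left=> x; rewrite dij_row_out.
case: j => [|j]; first by left=> x; rewrite dij_col0.
have [ij|ji] := ltnP i j.+1; first by left=> x; rewrite dij_above.
have pn : (i.-1 < n.-1)%N by lia.
have qn : (j < n.-1)%N by lia.
by right; exists (Ordinal pn), (Ordinal qn); rewrite /= prednK.
Qed.

Lemma dij_anti x i k j : (j <= i <= k)%N -> (dij x k j <= dij x i j)%N.
Proof.
have [->//|[p [q [-> ->]]]] := dij_cases k j.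
case: i => [|i] /andP[ji ip]; first by move: ji; rewrite ltn0.
have rn : (i < n.-1)%N by have := ltn_ord p; lia.
rewrite (dij_ord x p q) (dij_ord x (Ordinal rn) q).
have /andP[_ /forallP/(_ q)/forallP/(_ (Ordinal rn))/forallP/(_ p)] := fixptP x.
by move/implyP; apply; apply/andP; split; rewrite /=; lia.
Qed.

Lemma dij_inj x y : (forall i j, dij x i j = dij y i j) -> x = y.
Proof. by move=> xy; apply/val_inj/matrixP => p q; rewrite /= -!dij_ord xy. Qed.

Lemma ddeg_out x i : ~~ (0 < i < n)%N -> ddeg x i = 0%N.
Proof. by move=> iN; rewrite /ddeg big1 // => j _; rewrite dij_row_out. Qed.

Lemma ddeg_vac i : ddeg (vac n) i = 0%N.
Proof. by rewrite /ddeg big1 // => j _; rewrite dij_vac. Qed.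

Lemma corrP i x y :
  reflect [/\ forall k j, k != i -> dij x k j = dij y k j,
              forall j, (dij x i j <= dij y i j)%N
            & ddeg y i = (ddeg x i).+1]
          (corr i x y).
Proof.
apply: (iffP and3P) => [[xy1 xy2 /eqP xy3]|[xy1 xy2 xy3]]; split=> //.
- move=> k j ki; have [d0|[p [q [kp jq]]]] := dij_cases k j; first by rewrite !d0.
  move: ki; rewrite kp jq !dij_ord => ki.
  by apply/eqP; move/forallP: xy1 => /(_ p)/forallP/(_ q); rewrite ki.
- move=> j; have [->//|[p [q [kp jq]]]] := dij_cases i j.
  by move/forallP: xy2 => /(_ p)/forallP/(_ q); rewrite kp jq !dij_ord eqxx.
- apply/forallP => p; apply/forallP => q; apply/implyP => pi.
  by rewrite -!dij_ord xy1.
- apply/forallP => p; apply/forallP => q; apply/implyP => /eqP pi.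
  by rewrite -!dij_ord pi.
- exact/eqP.
Qed.

Lemma corr_ddeg i x y k : corr i x y -> ddeg y k = (ddeg x k + (k == i))%N.
Proof.
case/corrP => xy1 _ xy3; have [->|ki] := eqVneq; first by rewrite addn1.
by rewrite addn0; apply: eq_bigr => j _; rewrite xy1.
Qed.

(** The first place where [f] and [g] differ absorbs the whole excess 1; the remaining sums are then
    equal, and domination makes them equal termwise. Applied to row [i] of two flags, colength 1
    means one added box. *)
Lemma sum_succ_unique (r : seq nat) (f g : nat -> nat) :
  uniq r -> (forall j, f j <= g j)%N ->
  (\sum_(j <- r) g j)%N = (\sum_(j <- r) f j).+1 ->
  exists2 j0, j0 \in r & forall j, j \in r -> g j = (f j + (j == j0))%N.
Proof.
move=> + fg; elim: r => [|a r IH]; first by rewrite !big_nil.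
case/andP=> ar ur; rewrite !big_cons => gf.
have le_s : (\sum_(j <- r) f j <= \sum_(j <- r) g j)%N by apply: leq_sum.
have [ga|ga] := eqVneq (g a) (f a).
  case: IH => // [|j0 j0r Hr]; first by lia.
  exists j0; first by rewrite inE j0r orbT.
  move=> j; rewrite inE => /predU1P[->|/Hr//].
  by case: eqP => [aj|_]; [rewrite aj j0r in ar | rewrite ga addn0].
have fga := fg a.
exists a; first by rewrite inE eqxx.
move=> j; rewrite inE => /predU1P[->|jr]; first by rewrite eqxx; lia.
have /negPf -> : j != a by apply: contraNneq ar => <-.
have : (\sum_(j <- r) g j <= \sum_(j <- r) f j)%N by lia.
rewrite !(big_rem j jr) /= addn0 => le_gf; apply/eqP; rewrite eqn_leq fg andbT.
have le_r : (\sum_(k <- rem j r) f k <= \sum_(k <- rem j r) g k)%N by apply: leq_sum.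
by rewrite -(leq_add2r (\sum_(k <- rem j r) f k)) (leq_trans _ le_gf) // leq_add2l.
Qed.

Lemma corr_step i x y : corr i x y ->
  exists2 j0, (0 < j0 <= i)%N &
    forall k j, dij y k j = (dij x k j + ((k == i) && (j == j0)))%N.
Proof.
move=> /corrP[xy1 xy2 xy3].
have [j0 + Hj] := sum_succ_unique (iota_uniq _ _) xy2 xy3.
rewrite mem_index_iota ltnS => j0i; exists j0 => // k j.
have [->|ki] := eqVneq k i; last by rewrite addn0 xy1.
have [/Hj //|] := boolP (j \in index_iota 1 i.+1).
rewrite mem_index_iota ltnS => jN.
have /negPf -> : j != j0 by apply: contraNneq jN => ->.
case: j jN => [|j]; first by rewrite !dij_col0.
by rewrite /= -ltnNge => ij; rewrite !dij_above.
Qed.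

Lemma finite_bounded_patterns N :
  finite_set [set x : fixpt n | forall p q, (fixpt_mx x p q <= N)%N]%classic.
Proof.
(* [insubd] sends a matrix that is not a pattern to [vac n]; the image of [h] contains every bounded
   pattern. *)
pose h (A : 'M['I_N.+1]_n.-1) : fixpt n := insubd (vac n) (map_mx val A).
apply: (@sub_finite_set _ _ (h @` setT)%classic); last exact/finite_image/finite_finset.
move=> x /= xN; exists (map_mx inord (fixpt_mx x)) => //.
apply: val_inj; rewrite /h val_insubd.
have -> : map_mx val (map_mx inord (fixpt_mx x) : 'M['I_N.+1]_n.-1) = fixpt_mx x.
  by apply/matrixP => p q; rewrite !mxE /= inordK // ltnS.
by rewrite fixptP.
Qed.

Lemma pattern_bounded x : exists N, forall p q, (fixpt_mx x p q <= N)%N.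
Proof.
exists (\max_p \max_q fixpt_mx x p q)%N => p q.
exact: leq_trans (leq_bigmax q) (leq_bigmax (F := fun p => \max_q _)%N p).
Qed.

(** A sum over a set defaults to 0 when its support is infinite; finiteness in both directions makes
    the two push-forwards genuine sums. *)
Lemma finite_corr_up i x : finite_set [set y | corr i x y]%classic.
Proof.
have [N xN] := pattern_bounded x.
apply: sub_finite_set (finite_bounded_patterns N.+1) => y /= /corr_step[j0 _ yx] p q.
rewrite -dij_ord yx dij_ord; have := xN p q; case: (_ && _); lia.
Qed.

Lemma finite_corr_down i y : finite_set [set x | corr i x y]%classic.
Proof.
have [N yN] := pattern_bounded y.
apply: sub_finite_set (finite_bounded_patterns N) => x /= /corr_step[j0 _ yx] p q.
have := yN p q; rewrite -!dij_ord yx; lia.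
Qed.

(** Lowering the entry (r, j) by one keeps column j weakly decreasing because the entry below is
    strictly smaller. For r = n - 1 the row below is 0 by convention, so the entry only has to be
    positive. *)
Lemma remove_box x r j : (0 < j <= r)%N -> (dij x r.+1 j < dij x r j)%N ->
  exists x', corr r x' x.
Proof.
move=> jr lt_r.
have r_n : (0 < r < n)%N by apply: contraTT lt_r => /dij_row_out ->.
pose A : 'M[nat]_n.-1 :=
  \matrix_(p, q) (fixpt_mx x p q - ((p.+1 == r) && (q.+1 == j)))%N.
have AP : is_fixpt A.
  apply/andP; split.
    apply/forallP => p; apply/forallP => q; apply/implyP => pq.
    by rewrite mxE -dij_ord dij_above.
  apply/forallP => q; apply/forallP => p; apply/forallP => k.
  apply/implyP => qpk; rewrite !mxE.
  have [/andP[/eqP pr /eqP qj]|] := boolP ((p.+1 == r) && _); last first.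
    by move=> _; rewrite subn0 (leq_trans (leq_subr _ _)) // -!dij_ord dij_anti.
  have [kr|kr] := eqVneq k.+1 r.
    have -> : k = p by apply: val_inj => /=; lia.
    by rewrite qj eqxx.
  rewrite subn0 -!dij_ord qj pr.
  have : (dij x k.+1 j <= dij x r.+1 j)%N by apply: dij_anti; lia.
  by lia.
pose x' := FixPt AP.
have x'E k l : dij x' k l = (dij x k l - ((k == r) && (l == j)))%N.
  have [d0|[p [q [-> ->]]]] := dij_cases k l; first by rewrite !d0.
  by rewrite !dij_ord /x' mxE.
exists x'; apply/corrP; split=> [k l /negPf kr|l|].
- by rewrite x'E kr subn0.
- by rewrite x'E leq_subr.
have j_in : j \in index_iota 1 r.+1 by rewrite mem_index_iota.
rewrite /ddeg !(bigD1_seq j) ?iota_uniq //= x'E !eqxx.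
rewrite -addSn; congr (_ + _)%N; first by rewrite subn1 prednK //; lia.
by apply: eq_bigr => l /negPf lj; rewrite x'E lj andbF subn0.
Qed.

(** It always holds at [r = 0]; at [r = n], where row n is zero, it leaves only the zero pattern. *)
Definition const_upto r x := forall i j, (j <= i <= r)%N -> dij x i j = dij x r j.

Lemma const_upto0 x : const_upto 0 x.
Proof. by move=> i j /andP[_]; rewrite leqn0 => /eqP ->. Qed.

Lemma const_upto_n x : const_upto n x -> x = vac n.
Proof.
move=> xc; apply: dij_inj => i j; rewrite dij_vac.
have [ij|ji] := ltnP i j; first exact: dij_above.
have [/ltnW iN|iN] := ltnP i n; last by rewrite dij_row_out //; lia.
by rewrite xc ?ji // dij_row_out // ltnn andbF.
Qed.

(** Columns only decrease, so the hypothesis gives equality of rows r and r + 1 in columns 1 to r;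
    column r + 1 starts in the new row. Contrapositively, a failure of constancy exhibits a
    removable box. *)
Lemma const_uptoS r x : const_upto r x ->
  (forall j, (0 < j <= r)%N -> (dij x r j <= dij x r.+1 j)%N) -> const_upto r.+1 x.
Proof.
move=> xr xle i j /andP[ji]; rewrite leq_eqVlt => /predU1P[->//|]; rewrite ltnS => ir.
case: j ji => [|j] ji; first by rewrite !dij_col0.
rewrite xr ?ji //; apply/eqP; rewrite eqn_leq xle ?dij_anti //; lia.
Qed.

(** Only row r is in question. By constancy its entries in columns [j < r] are those of row r - 1,
    which is shared with [x']; the diagonal entry then follows from the degree of the row. This
    gives the triangularity of $E_r$. *)
Lemma const_upto_corr_inj r x' x y : const_upto r x -> const_upto r y ->
  corr r x' x -> corr r x' y -> x = y.
Proof.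
move=> xr yr x'x x'y; have dxy := corr_ddeg r x'x; rewrite -(corr_ddeg r x'y) in dxy.
case/corrP: x'x => xx _ _; case/corrP: x'y => yy _ _.
have E_lt j : (j < r)%N -> dij x r j = dij y r j.
  move=> jr; rewrite -(xr r.-1) -?(yr r.-1) ?leq_pred ?andbT; try lia.
  by rewrite -xx -?yy //; lia.
have E j : dij x r j = dij y r j.
  have [/E_lt//|rj] := ltnP j r.
  case: (ltngtP j r) rj => // [rj _|-> _]; first by rewrite !dij_above.
  case: r {xr yr xx yy} E_lt dxy => [|r] E_lt; first by rewrite !dij_col0.
  rewrite /ddeg !(@big_nat_recr _ _ _ r.+1) //=.
  under eq_big_nat => k /andP[_ kr] do rewrite E_lt //.
  by move/addnI.
apply: dij_inj => i j; have [->//|ir] := eqVneq i r.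
by rewrite -xx -?yy.
Qed.

Definition tdeg x := (\sum_(1 <= i < n) ddeg x i)%N.

Lemma corr_tdeg i x y : (0 < i < n)%N -> corr i x y -> tdeg y = (tdeg x).+1.
Proof.
move=> iN xy; rewrite /tdeg !(bigD1_seq i) ?iota_uniq ?mem_index_iota //=.
rewrite (corr_ddeg i xy) eqxx addn1 addSn; congr (_ + _).+1.
by apply: eq_bigr => k /negPf ki; rewrite (corr_ddeg k xy) ki addn0.
Qed.

End Patterns.

(** * The free module on the fixed points: coordinates and linear maps *)

Section FreeModule.
Variables (R : realType) (n : nat).
Local Notation F := (FF R n).
Local Notation M := (MM R n).
Local Notation cls := (fixcls R).
Implicit Types x y z : fixpt n.

Lemma mcoord_linear x : linear (fun G : M => mcoord G x : F^o).
Proof. by move=> a G1 G2; rewrite /mcoord coeffD coeffZ. Qed.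

Lemma mem_dom_mcoord (G : M) x :
  (x \in dom (G : {freeg (fixpt n) / F})) = (mcoord G x != 0).
Proof. exact: mem_dom. Qed.

Lemma mcoordDZ a (G1 G2 : M) x : mcoord (a *: G1 + G2) x = a * mcoord G1 x + mcoord G2 x.
Proof. exact: mcoord_linear. Qed.

Lemma mcoordZ a (G : M) x : mcoord (a *: G) x = a * mcoord G x.
Proof. exact: coeffZ. Qed.

Lemma mcoord_cls x y : mcoord (cls x) y = (x == y)%:R.
Proof. by rewrite /mcoord coeffU mul1r. Qed.

Lemma clsE (G : M) : G = \sum_(x <- dom (G : {freeg (fixpt n) / F})) mcoord G x *: cls x.
Proof.
apply/eqP/freeg_eqP => y; rewrite -[in LHS](freeg_sumE G) !raddf_sum.
by apply: eq_bigr => x _; rewrite /= coeffU coeffZ /fixcls coeffU mul1r.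
Qed.

Section Linear.
Variable V : lmodType F.

Lemma linear_zero (f : M -> V) : linear f -> f 0 = 0.
Proof. by move=> /(_ (-1) 0 0); rewrite scaler0 addr0 scaleN1r addNr. Qed.

Lemma linear_scale (f : M -> V) a G : linear f -> f (a *: G) = a *: f G.
Proof. by move=> fL; rewrite -[a *: G]addr0 fL linear_zero // addr0. Qed.

Lemma linear_sum_seq (f : M -> V) (I : Type) (r : seq I) (a : I -> F) (g : I -> M) :
  linear f -> f (\sum_(i <- r) a i *: g i) = \sum_(i <- r) a i *: f (g i).
Proof.
move=> fL; pose f' : {linear M -> V} := HB.pack f (GRing.isLinear.Build _ _ _ _ f fL).
by rewrite -[f]/(f' : _ -> _) linear_sum; apply: eq_bigr => i _; rewrite linearZ.
Qed.

Lemma linear_cls (f : M -> V) : linear f ->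
  forall G, f G = \sum_(x <- dom (G : {freeg (fixpt n) / F})) mcoord G x *: f (cls x).
Proof. by move=> fL G; rewrite {1}(clsE G) linear_sum_seq. Qed.

Lemma linear_ext (f g : M -> V) : linear f -> linear g ->
  (forall x, f (cls x) = g (cls x)) -> f =1 g.
Proof.
by move=> fL gL fg G; rewrite !linear_cls //; apply: eq_bigr => x _; rewrite fg.
Qed.

Lemma fglift_cls (f : fixpt n -> V) x : fglift f (cls x) = f x.
Proof. by rewrite liftU scale1r. Qed.

Lemma fglift_linear (f : fixpt n -> V) : linear (fglift f : M -> V).
Proof.
pose g : {additive {freeg (fixpt n) / F} -> V} :=
  HB.pack (fglift f) (GRing.isZmodMorphism.Build _ _ _ (lift_is_additive f)).
move=> a G1 G2; rewrite -[fglift f]/(g : _ -> _) raddfD; congr (_ + _).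
rewrite -[in RHS](freeg_sumE G1) [in RHS]raddf_sum scaler_sumr.
rewrite [LHS](raddf_sum g); apply: eq_bigr => x _.
by rewrite /= !liftU scalerA.
Qed.

End Linear.

(** * Fibres of $\mathfrak L_i$ and $\mathfrak D_{\underline d}$; matrix coefficients of $E_i$ and
    $F_i$ *)

Lemma SQ_neq0 x : SQ R x != 0.
Proof. by apply: Schi_neq0 => p /=; have := ltn_ord p; lia. Qed.

Lemma SE_neq0 i x y : SE R i x y != 0.
Proof. by apply: Schi_neq0 => -[a p] /=; have := ltn_ord p; case: a => /=; lia. Qed.

Lemma SQ_vac : SQ R (vac n) = 1.
Proof. by apply: Schi_eq1 => p j /=; rewrite dij_vac. Qed.

Lemma detRG_neq0 a j : detRG R n a j != 0.
Proof.
by rewrite mulf_neq0 ?invr_eq0 // prodf_seq_neq0; apply/allP => m _;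
   rewrite chmon_neq0 implybT.
Qed.

Lemma Dfib_neq0 x : Dfib R x != 0.
Proof.
rewrite prodf_seq_neq0; apply/allP => i _ /=.
by rewrite prodf_seq_neq0; apply/allP => j _; rewrite detRG_neq0.
Qed.

(** Passing from order a to a + 1 loses the section $z^0w_j$ if a = 0 and adds $z^aw_j$ to $H^1$ if
    a > 0; either way the determinant is divided by the character of $z^aw_j$. *)
Lemma detRG_succ a j : chmon R n j a%:Z * detRG R n a.+1 j = detRG R n a j.
Proof.
rewrite /detRG [X in _ * (X / _)]big_pred0 ?mul1r; last by move=> m; lia.
case: a => [|a]; first by rewrite !(@big_geq _ _ _ 1) // big_mkcond big_nat1 /= invr1 !mulr1.
rewrite [X in _ = X / _]big_pred0 ?mul1r; last by move=> m; lia.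
rewrite (@big_nat_recr _ _ _ a.+1) //= invfM mulrCA divff ?mulr1 //.
exact: chmon_neq0.
Qed.

Lemma Lfib_box i j x y : (0 < j <= i)%N ->
  (forall k l, dij y k l = (dij x k l + ((k == i) && (l == j)))%N) ->
  Lfib R i x y = chmon R n j (dij x i j)%:Z.
Proof.
move=> ji yx; rewrite /Lfib (bigD1_seq j) ?iota_uniq ?mem_index_iota //=.
rewrite yx !eqxx addn1 big_nat1 big1 ?addr0 // => l /negPf lj.
by rewrite yx lj andbF addn0 big_geq.
Qed.

Lemma Lfib_neq0 i x y : corr i x y -> Lfib R i x y != 0.
Proof. by case/corr_step => j ji yx; rewrite (Lfib_box ji yx) chmon_neq0. Qed.

(** Multiplicativity of the determinant for $0\to\mathcal W'_i\to\mathcal W_i\to\mathcal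
    W_i/\mathcal W'_i\to0$; the other $\mathcal W_k$ agree. The twist by $\mathfrak D$ thus absorbs
    the $\mathfrak L_i$ that occurs in $E_i$ but not in $F_i$. *)
Lemma Lfib_Dfib i x y : (0 < i < n)%N -> corr i x y -> Lfib R i x y * Dfib R y = Dfib R x.
Proof.
move=> iN /corr_step[j ji yx]; rewrite (Lfib_box ji yx) /Dfib.
have i_in : i \in index_iota 1 n by rewrite mem_index_iota.
have j_in : j \in index_iota 1 i.+1 by rewrite mem_index_iota.
rewrite (bigD1_seq i i_in (iota_uniq _ _)) [RHS](bigD1_seq i i_in (iota_uniq _ _)) /=.
rewrite mulrA; congr (_ * _); last first.
  by apply: eq_bigr => k /negPf ki; apply: eq_bigr => l _; rewrite yx ki addn0.
rewrite (bigD1_seq j j_in (iota_uniq _ _)) [RHS](bigD1_seq j j_in (iota_uniq _ _)) /=.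
rewrite mulrA; congr (_ * _); first by rewrite yx !eqxx addn1 detRG_succ.
by apply: eq_bigr => l /negPf lj; rewrite yx lj andbF addn0.
Qed.

Definition Ecoef i x : F :=
  - (tpar R n i.+1 ^ (- i%:Z - 1) * tpar R n i ^ (i%:Z - 1) *
      vpar R n ^ ((i%:Z - 1) * (ddeg x i.-1)%:Z + (i%:Z + 1) * (ddeg x i.+1)%:Z
           - 2 * i%:Z * (ddeg x i)%:Z - i%:Z)).

Definition Fcoef i y : F :=
  tpar R n i.+1 ^ i%:Z * tpar R n i ^ (- i%:Z) *
   vpar R n ^ (2 * i%:Z * (ddeg y i)%:Z - i%:Z * (ddeg y i.-1)%:Z
        - i%:Z * (ddeg y i.+1)%:Z - i%:Z).

Lemma Eop_cls i x : Eop i (cls x) = Ecoef i x *: qLp_push R i x.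
Proof. exact: fglift_cls. Qed.

Lemma Fop_cls i y : Fop i (cls y) = Fcoef i y *: pq_push R i y.
Proof. exact: fglift_cls. Qed.

Lemma Eop_linear i : linear (@Eop R n i).
Proof. exact: fglift_linear. Qed.

Lemma Fop_linear i : linear (@Fop R n i).
Proof. exact: fglift_linear. Qed.

Lemma Ecoef_neq0 i x : Ecoef i x != 0.
Proof. by rewrite oppr_eq0 !mulf_neq0 ?expfz_neq0 ?tpar_neq0 ?vpar_neq0. Qed.

Lemma qLp_pushE i x : qLp_push R i x =
  \sum_(y <- fset_set [set y | corr i x y]%classic)
     (Lfib R i x y * (SE R i x y / SQ R x)) *: cls y.
Proof. by rewrite /qLp_push fsbig_finite //; exact: finite_corr_up. Qed.

Lemma pq_pushE i y : pq_push R i y =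
  \sum_(x <- fset_set [set x | corr i x y]%classic) (SE R i x y / SQ R y) *: cls x.
Proof. by rewrite /pq_push fsbig_finite //; exact: finite_corr_down. Qed.

Lemma mcoord_sum (A : {fset fixpt n}) (a : fixpt n -> F) z :
  mcoord (\sum_(x <- A) a x *: cls x) z = if z \in A then a z else 0.
Proof.
rewrite (linear_sum_seq _ _ _ (mcoord_linear z)).
under eq_bigr => x _ do rewrite mcoord_cls.
case: ifP => zA; last first.
  rewrite big_seq big1 // => x xA; case: eqP => [xz|]; last by rewrite scaler0.
  by rewrite -xz xA in zA.
rewrite (bigD1_seq z) ?fset_uniq //= eqxx big1 ?addr0 => [|x /negPf ->].
  exact: mulr1.
exact: scaler0.
Qed.

Lemma mcoord_qLp_push i x y : mcoord (qLp_push R i x) y =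
  if corr i x y then Lfib R i x y * (SE R i x y / SQ R x) else 0.
Proof.
rewrite qLp_pushE mcoord_sum in_fset_set; last exact: finite_corr_up.
by congr (if _ then _ else _); apply/idP/idP; rewrite inE.
Qed.

Lemma mcoord_pq_push i y x : mcoord (pq_push R i y) x =
  if corr i x y then SE R i x y / SQ R y else 0.
Proof.
rewrite pq_pushE mcoord_sum in_fset_set; last exact: finite_corr_down.
by congr (if _ then _ else _); apply/idP/idP; rewrite inE.
Qed.

End FreeModule.

(** * The scalar in front of $[R\Gamma]$ *)

Section Prefactor.
Variables (R : realType) (n : nat).
Local Notation F := (FF R n).

(** The k-th terms of the prefactor involve $d_k$ and $d_{k-1}$, so a change of $d_i$ affects only k
    = i and k = i + 1. *)
Lemma big_adjacent (T : Type) (idx : T) (op : Monoid.com_law idx) i (f : nat -> T) :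
  (0 < i < n)%N -> \big[op/idx]_(1 <= k < n.+1) f k =
  op (f i) (op (f i.+1) (\big[op/idx]_(k <- index_iota 1 n.+1 | (k != i) && (k != i.+1)) f k)).
Proof.
move=> iN.
rewrite (bigD1_seq i) ?iota_uniq ?mem_index_iota //=; last by lia.
rewrite -big_filter (bigD1_seq i.+1) ?filter_uniq ?iota_uniq //=; last first.
  by rewrite mem_filter mem_index_iota; lia.
rewrite big_filter_cond; congr (op _ (op _ _)).
Qed.

Definition form_factor (d : nat -> nat) : F :=
  (-1) ^+ (\sum_(1 <= i < n) d i)%N
    * vpar R n ^ (\sum_(1 <= i < n) 2 * i%:Z * (d i)%:Z ^+ 2
                  - \sum_(2 <= i < n) (2 * i%:Z - 1) * (d i)%:Z * (d i.-1)%:Z)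
    * (\prod_(1 <= i < n.+1)
         tpar R n i ^ ((2 * i%:Z - 1) * ((d i.-1)%:Z - (d i)%:Z))).

(** Extends every range to 1, ..., n, so that i + 1 stays in range for i = n - 1; the added terms
    vanish by $d_0=d_n=0$. *)
Lemma form_factorE (d : nat -> nat) : (0 < n)%N -> d 0 = 0%N -> d n = 0%N ->
  form_factor d = (-1) ^+ (\sum_(1 <= i < n.+1) d i)%N
    * vpar R n ^ (\sum_(1 <= i < n.+1)
        (2 * i%:Z * (d i)%:Z ^+ 2 - (2 * i%:Z - 1) * (d i)%:Z * (d i.-1)%:Z))
    * (\prod_(1 <= i < n.+1)
         tpar R n i ^ ((2 * i%:Z - 1) * ((d i.-1)%:Z - (d i)%:Z))).
Proof.
move=> n0 d0 dn; rewrite !big_nat_recr //= dn addn0; congr (_ * _ ^ _ * _); last first.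
  by rewrite big_nat_recr //= dn.
rewrite expr0n mulr0 mulr0 mul0r subrr addr0 sumrB; congr (_ - _).
have [n2|n1] := ltnP 1 n; last by rewrite !big_geq //; lia.
by rewrite [RHS](big_ltn n2) /= d0 mulr0 add0r.
Qed.

Lemma form_factor0 : form_factor (fun=> 0%N) = 1.
Proof.
rewrite /form_factor big1_eq expr0 mul1r !big1 ?expr0z ?mul1r //.
- by move=> i _; rewrite subrr mulr0 expr0z.
- by move=> i _; rewrite !mulr0.
- by move=> i _; rewrite expr0n mulr0.
Qed.

(** Splits the comparison into the powers of $t_{i+1}$, $t_i$ and $v$. The minus sign of $E_i$
    cancels the extra sign of the added box; [s] and [T] are the unchanged sign and product. *)
Lemma mul_exchange (K : comRingType) (a b c a' b' c' s A B C T A' B' C' : K) :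
  a * A' = a' * A -> b * B' = b' * B -> c * C' = c' * C ->
  - (a * b * c) * ((-1) * s * C' * (B' * (A' * T))) = a' * b' * c' * (s * C * (B * (A * T))).
Proof.
move=> ha hb hc.
transitivity ((a * A') * (b * B') * (c * C') * (s * T)); first by ring.
by rewrite ha hb hc; ring.
Qed.

Lemma integrand_rearrange (K : fieldType) (a b c e f S : K) : S != 0 ->
  a * b * (c * (e / f) / S) = c * (a / S * (b / S) * e * S / f).
Proof.
move=> S0; have -> : a / S * (b / S) * e * S = a * b * e / S * (S / S) by ring.
by rewrite divff // mulr1; ring.
Qed.

Lemma form_factor_corr i (x y : fixpt n) : (0 < i < n)%N -> corr i x y ->
  Ecoef R i x * form_factor (ddeg y) = Fcoef R i y * form_factor (ddeg x).
Proof.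
move=> iN xy; have dy k := corr_ddeg k xy.
have n0 : (0 < n)%N by lia.
rewrite !form_factorE ?ddeg_out ?ltnn ?andbF //.
have iE : (i == i.+1) = false by lia.
have iE' : (i.+1 == i) = false by lia.
have iE'' : (i.-1 == i) = false by lia.
have dyi : ddeg y i = (ddeg x i).+1 by rewrite dy eqxx addn1.
have dyi' : ddeg y i.-1 = ddeg x i.-1 by rewrite dy iE'' addn0.
have dyi'' : ddeg y i.+1 = ddeg x i.+1 by rewrite dy iE' addn0.
have dyk k : k != i -> ddeg y k = ddeg x k by move=> /negPf ki; rewrite dy ki addn0.
rewrite !(big_adjacent _ _ iN) /=.
rewrite (eq_bigr (ddeg x)) => [|k /andP[/dyk//]].
rewrite [X in vpar R n ^ (_ + (_ + X))](eq_bigr (fun k => 2 * k%:Z * (ddeg x k)%:Z ^+ 2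
   - (2 * k%:Z - 1) * (ddeg x k)%:Z * (ddeg x k.-1)%:Z)); last first.
  by move=> k /andP[ki ki1]; rewrite !dyk //; lia.
rewrite [X in _ * (_ * (_ * (_ * X))) = _](eq_bigr (fun k =>
   tpar R n k ^ ((2 * k%:Z - 1) * ((ddeg x k.-1)%:Z - (ddeg x k)%:Z)))); last first.
  by move=> k /andP[ki ki1]; rewrite !dyk //; lia.
(* The box changes the exponents of $t_{i+1}$, $t_i$, $v$ by $2i+1$, $-(2i-1)$ and
   $4id_i+2i-(2i-1)d_{i-1}-(2i+1)d_{i+1}$. Added to those of $E_i$ at [x], these give the exponents
   of $F_i$ at [y]. *)
rewrite dyi dyi' dyi'' addSn exprS /Ecoef /Fcoef; apply: mul_exchange.
- rewrite -!expfzDr ?tpar_neq0 //; congr (_ ^ _); lia.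
- rewrite -!expfzDr ?tpar_neq0 //; congr (_ ^ _); lia.
- rewrite -!expfzDr ?vpar_neq0 //; congr (_ ^ _); rewrite /= dyi dyi' dyi''; nia.
Qed.

End Prefactor.

(** * The diagonal form: adjointness and uniqueness *)

Section Form.
Variables (R : realType) (n : nat).
Local Notation F := (FF R n).
Local Notation M := (MM R n).
Local Notation cls := (fixcls R).
Implicit Types x y z : fixpt n.

(** The two restrictions contribute [SQ x] to the power -2 and localization contributes [SQ x],
    whence a single inverse. Dividing by the fibre of $\mathfrak D$ at [vac n] normalizes the
    form. *)
Definition form_weight x : F :=
  form_factor R n (ddeg x) * (Dfib R x / Dfib R (vac n)) / SQ R x.

Definition form (G1 G2 : M) : F :=
  \sum_(x \in [set: fixpt n]) mcoord G1 x * mcoord G2 x * form_weight x.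

Lemma formC G1 G2 : form G1 G2 = form G2 G1.
Proof. by apply: eq_fsbigr => x _; rewrite [mcoord G1 x * _]mulrC. Qed.

Lemma form_seq (r : seq (fixpt n)) G1 G2 : uniq r ->
  {subset dom (G1 : {freeg (fixpt n) / F}) <= r} ->
  form G1 G2 = \sum_(x <- r) mcoord G1 x * mcoord G2 x * form_weight x.
Proof.
move=> ur G1r; rewrite /form (fsbigE r) // => [|x _ /=]; last first.
  move=> xr; rewrite /mcoord coeff_outdom ?mul0r //.
  by apply: contra xr => /G1r.
by apply: eq_bigl => x; rewrite in_setT.
Qed.

Lemma form_linear G : linear (fun G1 : M => form G1 G : F^o).
Proof.
move=> a G1 G2.
pose r := undup (dom (G1 : {freeg (fixpt n) / F}) ++ dom (G2 : {freeg (fixpt n) / F})).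
have mem_r x : (x \in r) = (mcoord G1 x != 0) || (mcoord G2 x != 0).
  by rewrite mem_undup mem_cat !mem_dom_mcoord.
rewrite (@form_seq r (a *: G1 + G2)) ?(@form_seq r G1) ?(@form_seq r G2) ?undup_uniq //.
- rewrite scaler_sumr -big_split; apply: eq_bigr => x _.
  by rewrite mcoordDZ !mulrDl -!mulrA.
- by move=> x; rewrite mem_r mem_dom_mcoord => G2x; apply/orP; right.
- by move=> x; rewrite mem_r mem_dom_mcoord => G1x; apply/orP; left.
move=> x; rewrite mem_r mem_dom_mcoord mcoordDZ.
have [->|_] := eqVneq (mcoord G1 x) 0; last by [].
by rewrite mulr0 add0r.
Qed.

Lemma form_linear_r G : linear (fun G2 : M => form G G2 : F^o).
Proof. by move=> a G1 G2; rewrite !(formC G) form_linear. Qed.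

Lemma form_cls x G : form (cls x) G = mcoord G x * form_weight x.
Proof.
rewrite (@form_seq [:: x]) //; first by rewrite big_seq1 mcoord_cls eqxx mul1r.
by move=> y; rewrite /fixcls domU1.
Qed.

Lemma form_adjoint i : (0 < i < n)%N ->
  forall G1 G2 : M, form (Eop i G1) G2 = form G1 (Fop i G2).
Proof.
move=> iN G1 G2; move: G1; apply: (@linear_ext _ _ F^o).
- by move=> a G1 G1'; rewrite Eop_linear form_linear.
- exact: form_linear.
move=> x; move: G2; apply: (@linear_ext _ _ F^o).
- exact: form_linear_r.
- by move=> a G2 G2'; rewrite Fop_linear form_linear_r.
move=> y; rewrite formC !form_cls Eop_cls Fop_cls.
rewrite [in LHS]mcoordZ [in RHS]mcoordZ mcoord_qLp_push mcoord_pq_push; case: ifP => xy; last first.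
  by rewrite !mulr0 !mul0r.
rewrite /form_weight -(Lfib_Dfib R iN xy).
(* Isolates the geometric factor common to both sides; only the scalar prefactors remain to be
   compared. *)
transitivity (Ecoef R i x * form_factor R n (ddeg y)
  * (Lfib R i x y * SE R i x y * Dfib R y / Dfib R (vac n) / SQ R x / SQ R y)).
  by ring.
by rewrite form_factor_corr //; ring.
Qed.

Lemma form_Shapovalov : is_Shapovalov form.
Proof.
split; first exact: formC.
- by move=> a G1 G2 G3; rewrite form_linear.
- rewrite form_cls mcoord_cls eqxx mul1r /form_weight SQ_vac divr1 divff ?Dfib_neq0 //.
  rewrite mulr1 -(form_factor0 R n); congr form_factor.
  by apply/funext => i; rewrite ddeg_vac.
- exact: form_adjoint.
Qed.

(** Generation by the $E_i$, phrased dually for a functional. The bound [N] restricts the hypothesis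
    to smaller total degree, where an induction can supply it. *)
Lemma cokernel_E (phi : M -> F^o) N : linear phi ->
  (forall i x', (0 < i < n)%N -> (tdeg x' < N)%N -> phi (Eop i (cls x')) = 0) ->
  forall x, (tdeg x <= N)%N -> x <> vac n -> phi (cls x) = 0.
Proof.
move=> phiL phiE x xN xv.
suff H r : (r <= n)%N -> forall z, (tdeg z <= N)%N -> ~ const_upto r z -> phi (cls z) = 0.
  by apply: (H n) => // /const_upto_n.
elim: r => [|r IH] rn z zN zr; first by case: zr; exact: const_upto0.
have [zr'|/(IH (ltnW rn) _ zN) //] := pselect (const_upto r z).
have [j jr lt_j] : exists2 j, (0 < j <= r)%N & (dij z r.+1 j < dij z r j)%N.
  apply: contrapT => no_j; apply: zr; apply: const_uptoS => // j jr.
  by rewrite leqNgt; apply/negP => lt_j; apply: no_j; exists j.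
have [z' z'z] := remove_box jr lt_j.
have r_n : (0 < r < n)%N by lia.
have z'N : (tdeg z' < N)%N by rewrite -(corr_tdeg r_n z'z).
have := phiE _ _ r_n z'N; rewrite Eop_cls qLp_pushE.
rewrite linear_scale // linear_sum_seq //.
rewrite (bigD1_seq z) ?fset_uniq //=; last first.
  by rewrite in_fset_set ?inE //; exact: finite_corr_up.
(* Any other term [y] of $E_r[z']$ fails constancy down to row r, as it would otherwise equal [z];
   the induction hypothesis kills it, leaving a nonzero multiple of [phi (cls z)]. *)
rewrite big_seq_cond big1 ?addr0; last first.
  move=> y; rewrite in_fset_set; last exact: finite_corr_up.
  case/andP=> /set_mem z'y /eqP yz; rewrite (IH (ltnW rn)) ?scaler0 //.
    by rewrite (corr_tdeg r_n z'y).
  by move=> yr; apply: yz; exact: const_upto_corr_inj yr zr' z'y z'z.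
move/eqP; rewrite !scaler_eq0 (negPf (Ecoef_neq0 _ _ _)) !mulf_eq0 invr_eq0.
rewrite (negPf (Lfib_neq0 _ z'z)) (negPf (SE_neq0 _ _ _ _)) (negPf (SQ_neq0 _ _)) /=.
by move/eqP.
Qed.

Lemma Fop_vac i : Fop i (cls (vac n)) = 0.
Proof.
rewrite Fop_cls /pq_push fsbig1 ?scaler0 // => x /= /(corr_ddeg i).
by rewrite ddeg_vac eqxx addn1.
Qed.

(** Meant for the difference of two Shapovalov forms: moving $E_i$ across as $F_i$ lowers the degree
    of the second argument until [vac n] is reached. *)
Lemma adjoint_form_eq0 (D : M -> M -> F^o) :
  (forall G1 G2, D G1 G2 = D G2 G1) -> (forall G, linear (D G)) ->
  (forall i, (0 < i < n)%N -> forall G1 G2, D G2 (Eop i G1) = D (Fop i G2) G1) ->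
  D (cls (vac n)) (cls (vac n)) = 0 -> forall G1 G2, D G1 G2 = 0.
Proof.
move=> DC DL DE D1.
have D0 G : D G 0 = 0 by exact: linear_zero (DL G).
have zeroL : linear (fun _ : M => 0 : F^o) by move=> a ? ?; rewrite scaler0 addr0.
(* By symmetry [vac n] may stand first; an $E_i$ in the second argument then becomes $F_i$ applied
   to [vac n], which is 0. *)
have Dvac G : D G (cls (vac n)) = 0.
  rewrite DC; move: G; apply: (@linear_ext _ _ F^o) => // y.
  have [->//|/eqP yv] := eqVneq y (vac n).
  apply: (cokernel_E (DL _)) (leqnn (tdeg y)) yv => i x' iN _.
  by rewrite DE // Fop_vac DC.
(* [G] stays universally quantified because the induction hypothesis is applied to [Fop i G]. *)
have Dcls N : forall x G, (tdeg x <= N)%N -> D G (cls x) = 0.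
  elim: N => [|N IH] x G xN; have [->//|/eqP xv] := eqVneq x (vac n).
    by apply: (cokernel_E (DL G)) xN xv => i x' _.
  by apply: (cokernel_E (DL G)) xN xv => i x' iN x'N; rewrite DE // IH.
move=> G1; apply: (@linear_ext _ _ F^o) => // x.
exact: Dcls (leqnn _).
Qed.

Lemma Shapovalov_unique B : is_Shapovalov B -> forall G1 G2, B G1 G2 = form G1 G2.
Proof.
case=> BC BL Bvac BE G1 G2; apply/eqP; rewrite -subr_eq0; apply/eqP; move: G1 G2.
have [_ _ fvac _] := form_Shapovalov.
apply: (@adjoint_form_eq0 (fun G1 G2 => B G1 G2 - form G1 G2)).
- by move=> G1 G2; rewrite BC formC.
- move=> G a G1 G2; rewrite !(BC G) BL form_linear_r.
  by rewrite scalerBr opprD addrACA.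
- by move=> i iN G1 G2; rewrite BC formC BE // form_adjoint // BC formC.
- by apply/eqP; rewrite subr_eq0 Bvac fvac.
Qed.

(** * Comparison of the diagonal form with $[R\Gamma]$ *)

Lemma ddeg_Qfix d x : Qfix d x -> ddeg x =1 dcomp d.
Proof.
move=> xd i; have [/xd//|iN] := boolP (0 < i < n)%N; rewrite ddeg_out //.
case: i iN => [|i] iN //; rewrite /dcomp /= nth_default // size_tuple; lia.
Qed.

Lemma form_RGamma d G1 G2 : inM d G1 ->
  form G1 G2 = form_factor R n (dcomp d)
    * (RGamma d (fun x => restr G1 x * restr G2 x * Dfib R x) / Dfib R (vac n)).
Proof.
move=> G1d; rewrite /form -(@fsbig_widen _ _ _ _ (Qfix d)) //; last first.
  move=> x [_ xd] /=; have [->|/G1d//] := eqVneq (mcoord G1 x) 0.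
  by rewrite !mul0r.
rewrite /RGamma mulr_fsuml mulr_fsumr; apply: eq_fsbigr => x; rewrite inE => xd.
rewrite /form_weight /restr (_ : ddeg x = dcomp d); last exact/funext/ddeg_Qfix.
exact: integrand_rearrange (SQ_neq0 _ _).
Qed.

End Form.

Theorem proposition2p29 (R : realType) (n : nat) (hn : (2 <= n)%N) :
  (exists B : MM R n -> MM R n -> FF R n, is_Shapovalov B) /\
  forall B : MM R n -> MM R n -> FF R n, is_Shapovalov B ->
  forall (d : n.-1.-tuple nat) (G1 G2 : MM R n), inM d G1 -> inM d G2 ->
  B G1 G2 =
    (-1) ^+ (\sum_(1 <= i < n) dcomp d i)%N
    * vpar R n ^ (\sum_(1 <= i < n) 2 * i%:Z * (dcomp d i)%:Z ^+ 2
                  - \sum_(2 <= i < n) (2 * i%:Z - 1) * (dcomp d i)%:Z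
                                        * (dcomp d i.-1)%:Z)
    * (\prod_(1 <= i < n.+1)
         tpar R n i ^ ((2 * i%:Z - 1) * ((dcomp d i.-1)%:Z - (dcomp d i)%:Z)))
    * (RGamma d (fun x => restr G1 x * restr G2 x * Dfib R x)
       / Dfib R (vac n)).
Proof.
split; first by exists (@form R n); exact: form_Shapovalov.
by move=> B BS d G1 G2 G1d _; rewrite (Shapovalov_unique BS) (form_RGamma _ G1d).
Qed.
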